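(* Let $p_3$, $\mathcal{Z}$, $\overline{\mathcal{X}}$ and $g_3$ be as defined in the context. Then $(\boldsymbol{x},\boldsymbol{U})$ is an optimal solution of $$\min_{(\boldsymbol{x},\boldsymbol{U})\in\overline{\mathcal{X}}}\ \max_{\boldsymbol{Z}\in\mathcal{Z}}\ g_3(\boldsymbol{x},\boldsymbol{U},\boldsymbol{Z})$$ if and only if there exist $(\boldsymbol{Y},\boldsymbol{R},\boldsymbol{\lambda})$, with $\boldsymbol{Y}=(\boldsymbol{Y}^1,\dots,\boldsymbol{Y}^{n+1})$ and $\boldsymbol{R}=(\boldsymbol{R}^1,\dots,\boldsymbol{R}^n)$ tuples of symmetric $n\times n$ matrices and $\boldsymbol{\lambda}\in\mathbb{R}^m$, such that $(\boldsymbol{x},\boldsymbol{U},\boldsymbol{Y},\boldsymbol{R},\boldsymbol{\lambda})$ is an optimal solution of the problem: minimize $-\sum_{j=1}^m\lambda_j s_j$ over $(\boldsymbol{x},\boldsymbol{U},\boldsymbol{Y},\boldsymbol{R},\boldsymbol{\lambda})$ subject to $$\boldsymbol{Y}^i+\sum_{j=1}^m\lambda_j\boldsymbol{A}_j^i\preceq\boldsymbol{0},\quad \boldsymbol{R}^i+\sum_{j=1}^m\lambda_j\boldsymbol{B}_j^i\preceq\boldsymbol{0}\quad (i\in[n]),\qquad \boldsymbol{Y}^{n+1}+\sum_{j=1}^m\lambda_j\boldsymbol{\Xi}_j\preceq\boldsymbol{0},$$ $$\boldsymbol{U}_i+\sum_{j=1}^m\lambda_j\boldsymbol{c}_j^i=\boldsymbol{0},\quad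 \boldsymbol{x}-\boldsymbol{U}_i+\sum_{j=1}^m\lambda_j\boldsymbol{d}_j^i=\boldsymbol{0}\quad(i\in[n]),\qquad \boldsymbol{x}+\sum_{j=1}^m\lambda_j\boldsymbol{\omega}_j=\boldsymbol{0},$$ $$x_i+\sum_{j=1}^m\lambda_j\mu_j^i=0,\quad 1-x_i+\sum_{j=1}^m\lambda_j\nu_j^i=0\quad(i\in[n]),\qquad 1+\sum_{j=1}^m\lambda_j\gamma_j=0,$$ $$\begin{pmatrix}\boldsymbol{Y}^i&\boldsymbol{U}_i\\ \boldsymbol{U}_i^T&x_i\end{pmatrix}\succeq\boldsymbol{0},\quad \begin{pmatrix}\boldsymbol{R}^i&\boldsymbol{x}-\boldsymbol{U}_i\\ (\boldsymbol{x}-\boldsymbol{U}_i)^T&1-x_i\end{pmatrix}\succeq\boldsymbol{0}\quad(i\in[n]),\qquad \begin{pmatrix}\boldsymbol{Y}^{n+1}&\boldsymbol{x}\\ \boldsymbol{x}^T&1\end{pmatrix}\succeq\boldsymbol{0},$$ $$(\boldsymbol{x},\boldsymbol{U})\in\overline{\mathcal{X}}.$$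
   Context: $[n]=\{1,\dots,n\}$; $\langle\cdot,\cdot\rangle$ is the trace inner product; $\succeq,\preceq$ denote the semidefinite order on symmetric matrices. Polynomial: $p_3(\boldsymbol{x})=\sum_{i\le j\le k}c^3_{ijk}x_ix_jx_k+\boldsymbol{x}^T\boldsymbol{c}^2\boldsymbol{x}+\boldsymbol{x}^T\boldsymbol{c}^1+c^0$ is a given real polynomial of degree 3 on $\mathbb{R}^n$. Decompositions: a decomposition of $p_3$ is an identity of polynomials $$p_3(\boldsymbol{x})=\sum_{i=1}^n x_i(\boldsymbol{x}^T\boldsymbol{P}^i\boldsymbol{x}+\boldsymbol{x}^T\boldsymbol{r}^i+w^i)+\sum_{i=1}^n(1-x_i)(\boldsymbol{x}^T\boldsymbol{Q}^i\boldsymbol{x}+\boldsymbol{x}^T\boldsymbol{f}^i+g^i)+\boldsymbol{x}^T\boldsymbol{P}'\boldsymbol{x}+\boldsymbol{x}^T\boldsymbol{r}'+w'.$$ Its parameters are $\boldsymbol{Z}=(\boldsymbol{P}^i,\boldsymbol{Q}^i,\boldsymbol{P}',\boldsymbol{r}^i,\boldsymbol{f}^i,\boldsymbol{r}',w^i,g^i,w')_{i\in[n]}$, with $\boldsymbol{P}^i,\boldsymbol{Q}^i,\boldsymbol{P}'$ symmetric $n\times n$ matrices, $\boldsymbol{r}^i,\boldsymbol{f}^i,\boldsymbol{r}'\in\mathbb{R}^n$, $w^i,g^i,w'\in\mathbb{R}$. Matching the coefficients of all monomials on both sides gives a system of $m$ linear equations in $\boldsymbol{Z}$, written for $j\in[m]$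 as $$\sum_{i=1}^n\Big(\langle\boldsymbol{A}_j^i,\boldsymbol{P}^i\rangle+\langle\boldsymbol{B}_j^i,\boldsymbol{Q}^i\rangle+(\boldsymbol{c}_j^i)^T\boldsymbol{r}^i+(\boldsymbol{d}_j^i)^T\boldsymbol{f}^i+\mu_j^iw^i+\nu_j^ig^i\Big)+\langle\boldsymbol{\Xi}_j,\boldsymbol{P}'\rangle+\boldsymbol{\omega}_j^T\boldsymbol{r}'+\gamma_jw'=s_j,$$ which defines the data $\boldsymbol{A}_j^i,\boldsymbol{B}_j^i,\boldsymbol{\Xi}_j$ (symmetric matrices), $\boldsymbol{c}_j^i,\boldsymbol{d}_j^i,\boldsymbol{\omega}_j$ (vectors), $\mu_j^i,\nu_j^i,\gamma_j,s_j$ (scalars). $\mathcal{Z}$ is the set of all $\boldsymbol{Z}$ satisfying these $m$ equations and $\boldsymbol{P}^i,\boldsymbol{Q}^i,\boldsymbol{P}'\succeq\boldsymbol{0}$ for all $i\in[n]$. Feasible region: $\mathcal{X}=\{\boldsymbol{x}\in\mathbb{R}^n:\boldsymbol{A}\boldsymbol{x}\le\boldsymbol{b},\ \boldsymbol{h}(\boldsymbol{x})\le\boldsymbol{0}\}$, with $\boldsymbol{h}=(h_1,\dots,h_J)$ and each $h_j$ proper, closed and convex; it is assumed that $\mathcal{X}\subseteq[0,1]^n$. $\overline{\mathcal{X}}$ is the convex set of pairs $(\boldsymbol{x},\boldsymbol{U})$, $\boldsymbol{x}\in\mathcal{X}$, $\boldsymbol{U}$ a symmetric $n\times n$ matrix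 with columns $\boldsymbol{U}_i$, described by the constraints of $\mathcal{X}$ together with the constraints obtained by multiplying constraints of $\mathcal{X}$ with each other and linearizing, replacing $\boldsymbol{x}\boldsymbol{x}^T$ by $\boldsymbol{U}$; in particular $(\boldsymbol{x},\boldsymbol{x}\boldsymbol{x}^T)\in\overline{\mathcal{X}}$ for all $\boldsymbol{x}\in\mathcal{X}$. Relaxed objective: $$g_3(\boldsymbol{x},\boldsymbol{U},\boldsymbol{Z})=\sum_{i=1}^n\Big[\tfrac1{x_i}\boldsymbol{U}_i^T\boldsymbol{P}^i\boldsymbol{U}_i+\boldsymbol{U}_i^T\boldsymbol{r}^i+w^ix_i+\tfrac1{1-x_i}(\boldsymbol{x}-\boldsymbol{U}_i)^T\boldsymbol{Q}^i(\boldsymbol{x}-\boldsymbol{U}_i)+(\boldsymbol{x}-\boldsymbol{U}_i)^T\boldsymbol{f}^i+(1-x_i)g^i\Big]+\boldsymbol{x}^T\boldsymbol{P}'\boldsymbol{x}+\boldsymbol{x}^T\boldsymbol{r}'+w'.$$ For $\boldsymbol{P}\succeq\boldsymbol{0}$ and $t=0$, the expression $\frac1t\boldsymbol{v}^T\boldsymbol{P}\boldsymbol{v}$ is read as $0$ if $\boldsymbol{v}^T\boldsymbol{P}\boldsymbol{v}=0$ and $+\infty$ otherwise. The inner maximum is understood as a supremum in $(-\infty,+\infty]$. *)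

(* Defs.v *)
From HB Require Import structures.
From mathcomp Require Import all_boot all_order all_algebra.
From mathcomp Require Import boolp classical_sets reals ereal topology.
From mathcomp Require Import normedtype convex.
(* The notations of mpoly clash with those of ereal and cannot be imported. *)
From mathcomp Require mpoly.
Export -(notations) mpoly.

Set Implicit Arguments.
Unset Strict Implicit.
Unset Printing Implicit Defensive.
Import Order.TTheory GRing.Theory Num.Theory.
Import numFieldNormedType.Exports.
Local Open Scope classical_set_scope.
Local Open Scope ring_scope.

Definition minimizer (d : Order.disp_t) (V : porderType d) (T : Type)
    (S : set T) (f : T -> V) (t : T) : Prop :=
  S t /\ forall t', S t' -> (f t <= f t')%O.

Section Vectors.
Context {R : realType}.

Definition dot n (u v : 'cV[R]_n) : R := (u^T *m v) 0 0.

Definition quad n (M : 'M[R]_n) (v : 'cV[R]_n) : R := dot v (M *m v).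

Definition trace_inner n (M N : 'M[R]_n) : R := \tr (M^T *m N).

Definition symmetric_mx n (M : 'M[R]_n) : Prop := M^T = M.

Definition psd n (M : 'M[R]_n) : Prop :=
  symmetric_mx M /\ forall v : 'cV[R]_n, 0 <= quad M v.

Definition sd_le n (M N : 'M[R]_n) : Prop := psd (N - M).

End Vectors.

Section Decompositions.
Context {R : realType} {n : nat}.

(* The parameters (P^i, Q^i, P', r^i, f^i, r', w^i, g^i, w'); primed symbols
   are spelled with a final 0. *)
Record params := Params {
  prP : 'I_n -> 'M[R]_n;  prQ : 'I_n -> 'M[R]_n;  prP0 : 'M[R]_n;
  prr : 'I_n -> 'cV[R]_n; prf : 'I_n -> 'cV[R]_n; prr0 : 'cV[R]_n;
  prw : 'I_n -> R;        prg : 'I_n -> R;        prw0 : R }.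

Definition var (i : 'I_n) : mpoly n R := mpolyX R (mnm1 i).

Definition qform (M : 'M[R]_n) : mpoly n R :=
  \sum_k \sum_l M k l *: (var k * var l).

Definition lform (v : 'cV[R]_n) : mpoly n R := \sum_k v k 0 *: var k.

Definition decomp (Z : params) : mpoly n R :=
  \sum_i var i * (qform (prP Z i) + lform (prr Z i) + mpolyC n (prw Z i))
  + \sum_i (1 - var i) * (qform (prQ Z i) + lform (prf Z i) + mpolyC n (prg Z i))
  + qform (prP0 Z) + lform (prr0 Z) + mpolyC n (prw0 Z).

(* One equation for each of the monomials of degree at most 3. *)
Definition nmon : nat := #|{: bmultinom n 4}|.

Definition mon (j : 'I_nmon) : multinom n := bmnm (enum_val j).

(* The data of the linear system. For instance the coefficient of mon j in
   x_i (x^T P x) is the sum over k, l of P_kl times the coefficient of mon j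
   in x_i x_k x_l, whence dataA; this matrix is visibly symmetric. *)
Definition dataA j i : 'M[R]_n :=
  \matrix_(k, l) mcoeff (mon j) (var i * (var k * var l)).
Definition dataB j i : 'M[R]_n :=
  \matrix_(k, l) mcoeff (mon j) ((1 - var i) * (var k * var l)).
Definition dataXi j : 'M[R]_n :=
  \matrix_(k, l) mcoeff (mon j) (var k * var l).
Definition datac j i : 'cV[R]_n := \col_k mcoeff (mon j) (var i * var k).
Definition datad j i : 'cV[R]_n := \col_k mcoeff (mon j) ((1 - var i) * var k).
Definition dataomega j : 'cV[R]_n := \col_k mcoeff (mon j) (var k).
Definition datamu j i : R := mcoeff (mon j) (var i).
Definition datanu j i : R := mcoeff (mon j) (1 - var i).
Definition datagamma j : R := mcoeff (mon j) (1 : mpoly n R).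
Definition datas (p : mpoly n R) j : R := mcoeff (mon j) p.

Definition coeff_eq (p : mpoly n R) (Z : params) (j : 'I_nmon) : Prop :=
  \sum_i (trace_inner (dataA j i) (prP Z i) + trace_inner (dataB j i) (prQ Z i)
          + dot (datac j i) (prr Z i) + dot (datad j i) (prf Z i)
          + datamu j i * prw Z i + datanu j i * prg Z i)
  + trace_inner (dataXi j) (prP0 Z) + dot (dataomega j) (prr0 Z)
  + datagamma j * prw0 Z = datas p j.

Definition Zset (p : mpoly n R) : set params :=
  [set Z | (forall j, coeff_eq p Z j)
    /\ (forall i, psd (prP Z i) /\ psd (prQ Z i)) /\ psd (prP0 Z)].

(* (1 / t) v^T P v for P psd, extended to t = 0. *)
Definition quad_over (t : R) (P : 'M[R]_n) (v : 'cV[R]_n) : \bar R :=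
  if t == 0 then (if quad P v == 0 then 0%E else +oo%E)
  else (t^-1 * quad P v)%:E.

Definition g3 (x : 'cV[R]_n) (U : 'M[R]_n) (Z : params) : \bar R :=
  (\sum_(i < n)
     (quad_over (x i ord0) (prP Z i) (col i U)
      + (dot (col i U) (prr Z i) + prw Z i * x i ord0)%R%:E
      + quad_over (1 - x i ord0)%R (prQ Z i) (x - col i U)%R
      + (dot (x - col i U) (prf Z i) + (1 - x i ord0) * prg Z i)%R%:E)
   + (quad (prP0 Z) x + dot x (prr0 Z) + prw0 Z)%R%:E)%E.

End Decompositions.
Arguments params : clear implicits.
Arguments nmon : clear implicits.

Section Region.
Context {R : realType} {n L J : nat}.

Definition proper_fun (f : 'cV[R]_n -> \bar R) : Prop :=
  (exists x, (f x < +oo)%E) /\ forall x, (-oo < f x)%E.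

Definition closed_fun (f : 'cV[R]_n -> \bar R) : Prop :=
  closed [set q : 'cV[R]_n * R | (f q.1 <= q.2%:E)%E].

Definition convex_fun (f : 'cV[R]_n -> \bar R) : Prop :=
  forall (x y : 'cV[R]_n) (t : R), 0 <= t <= 1 ->
    (f (t *: x + (1 - t) *: y)%R <= t%:E * f x + (1 - t)%:E * f y)%E.

Variables (A : 'M[R]_(L, n)) (b : 'cV[R]_L) (h : 'I_J -> 'cV[R]_n -> \bar R).

Definition region : set 'cV[R]_n :=
  [set x | (forall l, (A *m x) l 0 <= b l 0) /\ forall j, (h j x <= 0)%E].

(* The constraints defining the region, all read as 0 <= slack c x. *)
Definition slack (c : 'I_L + 'I_J) (x : 'cV[R]_n) : \bar R :=
  match c with
  | inl l => (b l 0 - (A *m x) l 0)%:E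
  | inr j => (- h j x)%E
  end.

(* The product (b_k - a_k^T x) (b_l - a_l^T x), with U in place of x x^T. *)
Definition linear_product (k l : 'I_L) (x : 'cV[R]_n) (U : 'M[R]_n) : R :=
  b k 0 * b l 0 - b k 0 * (A *m x) l 0 - b l 0 * (A *m x) k 0
  + (A *m U *m A^T) k l.

(* Phi c d linearizes the product of the slacks of c and d. Products of two
   linear constraints are linearized in the only possible way. A product
   involving a convex function has no canonical linearization (perspective
   functions, which may take infinite values, are the usual choice), so for
   these every Phi that gives back the product at U = x x^T is allowed. *)
Definition linearization
    (Phi : 'I_L + 'I_J -> 'I_L + 'I_J -> 'cV[R]_n -> 'M[R]_n -> \bar R) : Prop :=
  (forall k l x U, Phi (inl k) (inl l) x U = (linear_product k l x U)%:E) /\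
  (forall c d x, region x -> Phi c d x (x *m x^T) = (slack c x * slack d x)%E).

Definition lifted_region
    (Phi : 'I_L + 'I_J -> 'I_L + 'I_J -> 'cV[R]_n -> 'M[R]_n -> \bar R)
    : set ('cV[R]_n * 'M[R]_n) :=
  [set xU | [/\ region xU.1, symmetric_mx xU.2
              & forall c d, (0 <= Phi c d xU.1 xU.2)%E]].

End Region.

Section DualProblem.
Context {R : realType} {n : nat}.

(* Variables (x, U, Y, R, lambda) with Y = (Y^1, ..., Y^{n+1}); the last block
   Y^{n+1} is Y ord_max, the others are Y (widen_ord (leqnSn n) i). *)
Definition sdp_var : Type :=
  'cV[R]_n * 'M[R]_n * ('I_n.+1 -> 'M[R]_n) * ('I_n -> 'M[R]_n) * 'cV[R]_(nmon n).

Definition sdp_feasible (C : set ('cV[R]_n * 'M[R]_n)) : set sdp_var :=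
  [set v : sdp_var | let: (x, U, Y, W, lam) := v in
    let Yi i := Y (widen_ord (leqnSn n) i) in
    let Yn := Y ord_max in
    [/\ (forall k, symmetric_mx (Y k)) /\ (forall i, symmetric_mx (W i)),
        [/\ forall i, sd_le (Yi i + \sum_j lam j 0 *: dataA j i) 0,
            forall i, sd_le (W i + \sum_j lam j 0 *: dataB j i) 0
          & sd_le (Yn + \sum_j lam j 0 *: dataXi j) 0],
        [/\ forall i, col i U + \sum_j lam j 0 *: datac j i = 0,
            forall i, x - col i U + \sum_j lam j 0 *: datad j i = 0,
            x + \sum_j lam j 0 *: dataomega j = 0,
            forall i, x i 0 + \sum_j lam j 0 * datamu j i = 0
          & (forall i, 1 - x i 0 + \sum_j lam j 0 * datanu j i = 0)
            /\ 1 + \sum_j lam j 0 * datagamma j = 0],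
        [/\ forall i, psd (block_mx (Yi i) (col i U) (col i U)^T (x i 0)%:M),
            forall i, psd (block_mx (W i) (x - col i U)
                                    (x - col i U)^T (1 - x i 0)%:M)
          & psd (block_mx Yn x x^T 1%:M)]
      & C (x, U)]].

Definition sdp_objective (p : mpoly n R) (v : sdp_var) : R :=
  let: (x, U, Y, W, lam) := v in - \sum_j lam j 0 * datas p j.

End DualProblem.

Section Checks.
Context {R : realType} {n : nat}.

Lemma mcoeff_mul_qform (m : multinom n) (a : mpoly n R) (M : 'M[R]_n) :
  mcoeff m (a * qform M)
  = trace_inner (\matrix_(k, l) mcoeff m (a * (var k * var l))) M.
Proof.
rewrite /trace_inner /mxtrace /qform mulr_sumr raddf_sum /=.
under [RHS]eq_bigr => l _ do rewrite mxE.
rewrite exchange_big /=; apply: eq_bigr => k _.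
rewrite mulr_sumr raddf_sum /=; apply: eq_bigr => l _.
by rewrite -scalerAr mcoeffZ !mxE mulrC.
Qed.

Lemma mcoeff_mul_lform (m : multinom n) (a : mpoly n R) (v : 'cV[R]_n) :
  mcoeff m (a * lform v) = dot (\col_k mcoeff m (a * var k)) v.
Proof.
rewrite /dot mxE /lform mulr_sumr raddf_sum /=; apply: eq_bigr => k _.
by rewrite -scalerAr mcoeffZ !mxE mulrC.
Qed.

Lemma mcoeff_decomp (m : multinom n) (Z : params R n) :
  mcoeff m (decomp Z) =
  \sum_i
    (trace_inner (\matrix_(k, l) mcoeff m (var i * (var k * var l))) (prP Z i)
     + trace_inner (\matrix_(k, l) mcoeff m ((1 - var i) * (var k * var l)))
         (prQ Z i)
     + dot (\col_k mcoeff m (var i * var k)) (prr Z i)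
     + dot (\col_k mcoeff m ((1 - var i) * var k)) (prf Z i)
     + mcoeff m (var i) * prw Z i + mcoeff m (1 - var i) * prg Z i)
  + trace_inner (\matrix_(k, l) mcoeff m (var k * var l)) (prP0 Z)
  + dot (\col_k mcoeff m (var k)) (prr0 Z)
  + mcoeff m (1 : mpoly n R) * prw0 Z.
Proof.
have mulC (a : mpoly n R) c : mcoeff m (a * mpolyC n c) = mcoeff m a * c.
  by rewrite mulrC mcoeffCM mulrC.
rewrite /decomp !mcoeffD 2!raddf_sum -big_split /=.
congr (_ + _ + _ + _); last by rewrite -mulC mul1r.
- apply: eq_bigr => i _; rewrite !mulrDr !mcoeffD !mulC.
  rewrite !mcoeff_mul_qform !mcoeff_mul_lform.
  by rewrite [LHS](AC (3*3) (1*4*2*5*3*6)) /= mcoeffD.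
- rewrite -[qform _]mul1r mcoeff_mul_qform.
  by congr trace_inner; apply/matrixP => k l; rewrite !mxE mul1r.
- rewrite -[lform _]mul1r mcoeff_mul_lform.
  by congr dot; apply/matrixP => k l; rewrite !mxE mul1r.
Qed.

(* The linear system is the identity of polynomials p = decomp Z. *)
Lemma coeff_eqP (p : mpoly n R) (Z : params R n) :
  (msize p <= 4)%N -> (forall j, coeff_eq p Z j) <-> p = decomp Z.
Proof.
move=> p4; split=> [eqs|-> j]; last by rewrite /coeff_eq /datas mcoeff_decomp.
apply/mpolyP => m; case: (ltnP (mdeg m) 4) => [m4|m4].
  have := eqs (enum_rank (BMultinom m4)).
  by rewrite /coeff_eq /datas -mcoeff_decomp /mon enum_rankK.
rewrite memN_msupp_eq0; last exact: msize_mdeg_ge (leq_trans p4 m4).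
have X0 m' : (mdeg m' < 4)%N -> mcoeff m (mpolyX R m') = 0.
  by rewrite mcoeffX => m'4; case: eqP => // mm'; rewrite -mm' leqNgt m'4 in m4.
have X1 i : mcoeff m (var i : mpoly n R) = 0.
  by rewrite /var; apply: X0; rewrite mdeg1.
have X2 i k : mcoeff m (var i * var k : mpoly n R) = 0.
  by rewrite /var -mpolyXD; apply: X0; rewrite mdegD !mdeg1.
have X3 i k l : mcoeff m (var i * (var k * var l) : mpoly n R) = 0.
  by rewrite /var -!mpolyXD; apply: X0; rewrite !mdegD !mdeg1.
have one0 : mcoeff m (1 : mpoly n R) = 0.
  by rewrite -mpolyX0; apply: X0; rewrite mdeg0.
have tr0 (M N : 'M[R]_n) : (forall k l, M k l = 0) -> trace_inner M N = 0.
  move=> M0; rewrite /trace_inner (_ : M = 0) ?trmx0 ?mul0mx ?mxtrace0 //.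
  by apply/matrixP => k l; rewrite mxE.
have dot0 (u v : 'cV[R]_n) : (forall k, u k 0 = 0) -> dot u v = 0.
  move=> u0; rewrite /dot (_ : u = 0) ?trmx0 ?mul0mx ?mxE //.
  by apply/matrixP => k l; rewrite (ord1 l) mxE.
rewrite mcoeff_decomp one0 mul0r !tr0 ?dot0 ?big1 ?addr0 // => *.
- rewrite !tr0 ?dot0 ?mcoeffB ?X1 ?one0 ?subr0 ?mul0r ?addr0 // => *;
  by rewrite !mxE ?mulrBl ?mul1r ?mcoeffB ?X1 ?X2 ?X3 ?subr0.
- by rewrite mxE X1.
- by rewrite mxE X2.
Qed.

Lemma rank1_lifted_region (L J : nat) (A : 'M[R]_(L, n)) (b : 'cV[R]_L)
    (h : 'I_J -> 'cV[R]_n -> \bar R) Phi x :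
  linearization A b h Phi -> region A b h x ->
  lifted_region A b h Phi (x, x *m x^T).
Proof.
move=> [_ PhiE] xX; split => //=; first by rewrite /symmetric_mx trmx_mul trmxK.
have s0 c : (0 <= slack A b h c x)%E.
  by case: c xX => [l|j] [Ax hx] /=; rewrite ?lee_fin ?subr_ge0// leeNr oppe0.
by move=> c d; rewrite PhiE// mule_ge0.
Qed.

End Checks.

(* Main.v *)
Require Import Defs.
From mathcomp Require Import all_boot all_order all_algebra.
From mathcomp Require Import boolp classical_sets reals ereal topology.
From mathcomp Require Import normedtype convex.
From mathcomp Require Import ring lra.
Set Implicit Arguments.
Unset Strict Implicit.
Unset Printing Implicit Defensive.
Import Order.TTheory GRing.Theory Num.Theory.
Import numFieldNormedType.Exports.
Local Open Scope classical_set_scope.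
Local Open Scope ring_scope.

(** Fix a point (x, U).  The constraints on lambda say that it is a linear
    functional on polynomials of degree at most 3 for which the functional Z |-> <(Y, R, U, x, ...), Z> + lambda (A Z) lies in the polar
    of the cone K of parameter tuples with positive semidefinite matrices; here
    A Z is the vector of coefficients of the polynomial decomposed by Z.  So
    the second problem is the first one with the inner maximum, a conic program
    in Z, replaced by its dual.

    Weak duality ([g3_le_sdp_objective]): by Schur complements ([psd_block])
    the block constraints give Y^i >= U_i U_i^T / x_i, hence g3 is at most the
    pairing of Z with the dual blocks ([g3_le_pairing]), and this is at most
    - lambda s because trace inner products of positive semidefinite matrices
    are nonnegative.

    Strong duality with attainment ([sdp_feasible_of_bounded]): the map A sends
    K onto all polynomials of degree at most 3 ([coef_surj]), by the
    polarization identity of [decomposable_lform3].  This plays the part of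
    Slater's condition.  If the inner supremum at (x, U) is not +oo, then U_i
    vanishes when x_i = 0 and x - U_i vanishes when x_i = 1
    ([nondegenerate_of_bounded]), so g3 is linear in Z ([g3_nondegenerate]).
    The value function of the conic program is then finite everywhere and
    superlinear, and a Hahn-Banach argument ([cone_duality]) gives the
    multiplier lambda; the blocks Y, R are the smallest ones that their Schur
    complements allow, such as U_i U_i^T / x_i.

    Finally the minimum of the min-max problem is not +oo, since g3 takes the
    value p3(x) at (x, x x^T) ([g3_rank1]).  The equivalence of the minimizers
    then follows from the two dualities. *)

(** * Sublinear functions and cone duality *)

Section Sublinear.
Context {R : realType}.

(** Subadditivity and homogeneity for positive scalars.  The inequality stated
    for homogeneity implies equality, as [c] may be replaced by its inverse. *)
Definition sublinear (V : lmodType R) (q : V -> R) : Prop :=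
  (forall u v, q (u + v) <= q u + q v) /\
  (forall c u, 0 < c -> q (c *: u) <= c * q u).

Lemma sublinear0 (V : lmodType R) (q : V -> R) : sublinear q -> q 0 = 0.
Proof.
move=> [_ qZ]; have h0 : 0 < 2^-1 :> R by rewrite invr_gt0 ltr0n.
have := qZ 2 0 (ltr0Sn R 1); have := qZ 2^-1 0 h0; rewrite !scaler0.
by lra.
Qed.

Lemma sublinear_oppr (V : lmodType R) (q : V -> R) u :
  sublinear q -> - q (- u) <= q u.
Proof.
by move=> sq; have := sq.1 u (- u); rewrite subrr sublinear0//; lra.
Qed.

(** The function [v |-> inf_(t >= 0) q (v + t e) - t q(e)] is sublinear, lies
    below [q] and is linear along [e]. *)
Lemma sublinear_flatten (V : lmodType R) (q : V -> R) (e : V) :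
  sublinear q ->
  exists q' : V -> R,
    [/\ sublinear q', forall v, q' v <= q v & q' (- e) <= - q e].
Proof.
move=> sq; have [qD qZ] := sq.
pose E v : set R := [set q (v + t *: e) - t * q e | t in [set t | 0 <= t]].
have qte t : 0 <= t -> q (t *: e) <= t * q e.
  rewrite le0r => /orP[/eqP->|]; last exact: qZ.
  by rewrite scale0r mul0r sublinear0.
have qtV t : 0 <= t -> t * q e <= q (t *: e).
  rewrite le0r => /orP[/eqP->|t0]; first by rewrite scale0r mul0r sublinear0.
  have := qZ t^-1 (t *: e); rewrite invr_gt0 => /(_ t0).
  by rewrite scalerA mulVf ?gt_eqF// scale1r ler_pdivlMl.
have lbE v : lbound (E v) (- q (- v)).
  move=> _ [t /= t0 <-]; have := qD (v + t *: e) (- v).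
  by rewrite addrAC subrr add0r; have := qtV t t0; lra.
have EI v : has_inf (E v).
  by split; [exists (q (v + 0 *: e) - 0 * q e); exists 0 => /= | exists (- q (- v))].
have infE v t : 0 <= t -> inf (E v) <= q (v + t *: e) - t * q e.
  by move=> t0; apply: ge_inf; [exact: (EI v).2 | exists t].
exists (fun v => inf (E v)); split.
- split=> [u v|c u c0].
    suff: inf (E (u + v)) - inf (E v) <= inf (E u) by lra.
    apply: lb_le_inf => [|_ [t /= t0 <-]]; first exact: (EI u).1.
    suff: inf (E (u + v)) - (q (u + t *: e) - t * q e) <= inf (E v) by lra.
    apply: lb_le_inf => [|_ [s /= s0 <-]]; first exact: (EI v).1.
    have := infE (u + v) (t + s) (addr_ge0 t0 s0).
    have := qD (u + t *: e) (v + s *: e).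
    by rewrite addrACA -scalerDl; lra.
  rewrite -ler_pdivrMl//; apply: lb_le_inf => [|_ [t /= t0 <-]].
    exact: (EI u).1.
  rewrite ler_pdivrMl//; have := infE (c *: u) (c * t) (mulr_ge0 (ltW c0) t0).
  by have := qZ c (u + t *: e) c0; rewrite scalerDr scalerA; lra.
- by move=> v; have := infE v 0 (lexx 0); rewrite scale0r addr0 mul0r subr0.
- have := infE (- e) 1 ler01; rewrite scale1r addNr sublinear0//; lra.
Qed.

(** Flattening along successive directions: linearity along a direction is
    not lost when a sublinear function is replaced by a smaller one. *)
Lemma sublinear_flatten_seq (V : lmodType R) (es : seq V) (q : V -> R) :
  sublinear q ->
  exists q' : V -> R,
    [/\ sublinear q', forall v, q' v <= q v
      & forall e, e \in es -> q' (- e) <= - q' e].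
Proof.
elim: es q => [|e es IH] q sq; first by exists q; split.
have [q1 [sq1 q1q q1e]] := sublinear_flatten e sq.
have [q2 [sq2 q2q1 q2es]] := IH _ sq1.
exists q2; split=> // [v|e']; first exact: le_trans (q2q1 v) (q1q v).
rewrite in_cons => /orP[/eqP->|]; last exact: q2es.
by have := q2q1 (- e); have := q2q1 e; have := q1q e; lra.
Qed.

Lemma dotE n (u v : 'cV[R]_n) : dot u v = \sum_k u k 0 * v k 0.
Proof. by rewrite /dot mxE; apply: eq_bigr => k _; rewrite mxE. Qed.

(** Hahn-Banach theorem in coordinates: a sublinear function on a coordinate
    space dominates a linear form that agrees with it at a given point. *)
Lemma hahn_banach m (q : 'cV[R]_m -> R) (s0 : 'cV[R]_m) :
  sublinear q ->
  exists lam : 'cV[R]_m, (forall s, dot lam s <= q s) /\ q s0 <= dot lam s0.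
Proof.
move=> sq; have [q1 [sq1 q1q q1s0]] := sublinear_flatten s0 sq.
pose es := [seq delta_mx j (0 : 'I_1) | j <- enum 'I_m] : seq 'cV[R]_m.
have [q2 [sq2 q2q1 q2es]] := sublinear_flatten_seq es sq1.
pose lam := (\col_j q2 (delta_mx j 0)) : 'cV[R]_m.
have ge_lam s : q2 s <= dot lam s.
  have q2sum (I : Type) (r : seq I) (F : I -> 'cV[R]_m) :
      q2 (\sum_(i <- r) F i) <= \sum_(i <- r) q2 (F i).
    elim: r => [|i r IH]; first by rewrite !big_nil sublinear0.
    by rewrite !big_cons (le_trans (sq2.1 _ _))// lerD2l.
  rewrite {1}[s]matrix_sum_delta dotE (le_trans (q2sum _ _ _))//.
  apply: ler_sum => j _; rewrite big_ord1 mxE.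
  have q2j : q2 (- delta_mx j 0) <= - q2 (delta_mx j 0).
    by apply: q2es; apply/mapP; exists j; rewrite ?mem_enum.
  case: (ltrgt0P (s j 0)) => [s0j|s0j|->]; first by rewrite mulrC; apply: sq2.2.
    have s1 : 0 < - s j 0 by rewrite oppr_gt0.
    rewrite -[s j 0]opprK scaleNr -scalerN (le_trans (sq2.2 _ _ s1))//.
    by nra.
  by rewrite scale0r mulr0 sublinear0.
have lamN s : dot lam (- s) = - dot lam s.
  by rewrite /dot mulmxN mxE.
exists lam; split=> [s|].
  have := ge_lam (- s); have := sublinear_oppr s sq2; have := q2q1 s.
  by have := q1q s; rewrite lamN; lra.
have := ge_lam s0; have := sublinear_oppr s0 sq2; have := q2q1 (- s0).
by lra.
Qed.

(** Duality for a convex cone [G] of pairs (right-hand side, value) that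
    reaches every right-hand side: if the values over [s0] are at most [v],
    then a linear form bounds all values and is at most [v] at [s0]. *)
Lemma cone_duality m (G : 'cV[R]_m -> R -> Prop) (s0 : 'cV[R]_m) (v : R) :
  (forall s s' r r', G s r -> G s' r' -> G (s + s') (r + r')) ->
  (forall c s r, 0 < c -> G s r -> G (c *: s) (c * r)) ->
  (forall s, exists r, G s r) ->
  (forall r, G s0 r -> r <= v) ->
  exists lam : 'cV[R]_m,
    (forall s r, G s r -> r + dot lam s <= 0) /\ - dot lam s0 <= v.
Proof.
move=> GD GZ Gex Gv.
pose E s : set R := [set - r | r in G s].
have EI s : has_inf (E s).
  split; first by have [r Gr] := Gex s; exists (- r); exists r.
  have [r' Gr'] := Gex (s0 - s); exists (r' - v) => _ [r Gr <-].
  by have := GD _ _ _ _ Gr' Gr; rewrite subrK => /Gv; lra.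
have infE s r : G s r -> inf (E s) <= - r.
  by move=> Gr; apply: ge_inf; [exact: (EI s).2 | exists r].
have sq : sublinear (fun s => inf (E s)).
  split=> [s s'|c s c0].
    suff: inf (E (s + s')) - inf (E s) <= inf (E s') by lra.
    apply: lb_le_inf => [|_ [r Gr <-]]; first exact: (EI s').1.
    suff: inf (E (s + s')) + r <= inf (E s) by lra.
    apply: lb_le_inf => [|_ [r' Gr' <-]]; first exact: (EI s).1.
    by have := infE _ _ (GD _ _ _ _ Gr' Gr); lra.
  rewrite -ler_pdivrMl//; apply: lb_le_inf => [|_ [r Gr <-]].
    exact: (EI s).1.
  by rewrite ler_pdivrMl// mulrN; apply: infE; apply: GZ.
have [lam [lamq lams0]] := hahn_banach s0 sq.
exists lam; split=> [s r Gr|]; first by have := lamq s; have := infE s r Gr; lra.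
have : - v <= inf (E s0); last by lra.
apply: lb_le_inf => [|_ [r Gr <-]]; first exact: (EI s0).1.
by rewrite lerN2; apply: Gv.
Qed.

End Sublinear.

(** * Positive semidefinite matrices *)

Section Forms.
Context {R : realType}.

Lemma dotC n (u v : 'cV[R]_n) : dot u v = dot v u.
Proof. by rewrite !dotE; apply: eq_bigr => k _; rewrite mulrC. Qed.

Lemma dotDl n (u v w : 'cV[R]_n) : dot (u + v) w = dot u w + dot v w.
Proof. by rewrite /dot linearD mulmxDl mxE. Qed.

Lemma dotZl n c (u w : 'cV[R]_n) : dot (c *: u) w = c * dot u w.
Proof. by rewrite /dot linearZ -scalemxAl mxE. Qed.

Lemma dotDr n (u v w : 'cV[R]_n) : dot w (u + v) = dot w u + dot w v.
Proof. by rewrite !(dotC w) dotDl. Qed.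

Lemma dotZr n c (u w : 'cV[R]_n) : dot w (c *: u) = c * dot w u.
Proof. by rewrite !(dotC w) dotZl. Qed.

Lemma dot0r n (u : 'cV[R]_n) : dot u 0 = 0.
Proof. by rewrite /dot mulmx0 mxE. Qed.

Lemma dot0l n (u : 'cV[R]_n) : dot 0 u = 0.
Proof. by rewrite dotC dot0r. Qed.

Lemma dot_delta n (u : 'cV[R]_n) k : dot u (delta_mx k 0) = u k 0.
Proof.
rewrite dotE (bigD1 k)//= !mxE !eqxx mulr1 big1 ?addr0// => i ik.
by rewrite mxE (negbTE ik) mulr0.
Qed.

Lemma dot_eq0 n (u : 'cV[R]_n) : dot u u = 0 -> u = 0.
Proof.
rewrite dotE => /eqP; rewrite psumr_eq0 => [/allP u0|k _]; last exact: sqr_ge0.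
apply/matrixP => k j; rewrite (ord1 j) mxE; apply/eqP.
by have := u0 k (mem_index_enum _); rewrite /= mulf_eq0 orbb.
Qed.

Lemma dot_col_mx m n (u : 'cV[R]_m) (v : 'cV[R]_n) u' v' :
  dot (col_mx u v) (col_mx u' v') = dot u u' + dot v v'.
Proof. by rewrite /dot tr_col_mx mul_row_col mxE. Qed.

Lemma trace_innerE n (M N : 'M[R]_n) :
  trace_inner M N = \sum_k \sum_l M k l * N k l.
Proof.
rewrite /trace_inner /mxtrace exchange_big /=; apply: eq_bigr => l _.
by rewrite mxE; apply: eq_bigr => k _; rewrite mxE.
Qed.

Lemma trace_innerC n (M N : 'M[R]_n) : trace_inner M N = trace_inner N M.
Proof.
by rewrite !trace_innerE; do 2!apply: eq_bigr => ? _; rewrite mulrC.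
Qed.

Lemma trace_innerDl n (M N P : 'M[R]_n) :
  trace_inner (M + N) P = trace_inner M P + trace_inner N P.
Proof. by rewrite /trace_inner linearD mulmxDl mxtraceD. Qed.

Lemma trace_innerZl n c (M P : 'M[R]_n) :
  trace_inner (c *: M) P = c * trace_inner M P.
Proof. by rewrite /trace_inner linearZ -scalemxAl mxtraceZ. Qed.

Lemma trace_inner0l n (P : 'M[R]_n) : trace_inner 0 P = 0.
Proof. by rewrite /trace_inner trmx0 mul0mx mxtrace0. Qed.

Lemma trace_inner_rank1 n (M : 'M[R]_n) (u : 'cV[R]_n) :
  trace_inner (u *m u^T) M = quad M u.
Proof.
rewrite /trace_inner trmx_mul trmxK -mulmxA mxtrace_mulC /quad /dot -mulmxA.
by rewrite /mxtrace big_ord1.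
Qed.

Lemma quadE n (M : 'M[R]_n) v : quad M v = \sum_k \sum_l M k l * (v k 0 * v l 0).
Proof.
rewrite -trace_inner_rank1 trace_innerC trace_innerE.
by do 2!apply: eq_bigr => ? _; rewrite !mxE big_ord1 mxE.
Qed.

Lemma quadD n (M N : 'M[R]_n) v : quad (M + N) v = quad M v + quad N v.
Proof. by rewrite /quad mulmxDl dotDr. Qed.

Lemma quadZ n c (M : 'M[R]_n) v : quad (c *: M) v = c * quad M v.
Proof. by rewrite /quad -scalemxAl dotZr. Qed.

Lemma quadN n (M : 'M[R]_n) v : quad (- M) v = - quad M v.
Proof. by rewrite -scaleN1r quadZ mulN1r. Qed.

Lemma quad0r n (M : 'M[R]_n) : quad M 0 = 0.
Proof. by rewrite /quad mulmx0 dot0r. Qed.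

Lemma quadZr n c (M : 'M[R]_n) v : quad M (c *: v) = c ^+ 2 * quad M v.
Proof. by rewrite /quad -scalemxAr dotZl dotZr mulrA. Qed.

Lemma quad_rank1 n (u v : 'cV[R]_n) : quad (u *m u^T) v = dot u v ^+ 2.
Proof.
rewrite /quad -mulmxA [u^T *m v]mx11_scalar -/(dot u v) mul_mx_scalar dotZr.
by rewrite dotC expr2.
Qed.

Lemma quad_delta n (M : 'M[R]_n) k : quad M (delta_mx k 0) = M k k.
Proof.
by rewrite /quad dotC dot_delta -colE mxE.
Qed.

End Forms.

Section Psd.
Context {R : realType}.

Lemma symmetric_rank1 n (u : 'cV[R]_n) : symmetric_mx (u *m u^T).
Proof. by rewrite /symmetric_mx trmx_mul trmxK. Qed.

Lemma symmetricD n (M N : 'M[R]_n) :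
  symmetric_mx M -> symmetric_mx N -> symmetric_mx (M + N).
Proof. by rewrite /symmetric_mx linearD /= => -> ->. Qed.

Lemma symmetricZ n c (M : 'M[R]_n) : symmetric_mx M -> symmetric_mx (c *: M).
Proof. by rewrite /symmetric_mx linearZ /= => ->. Qed.

Lemma psd_rank1 n (u : 'cV[R]_n) : psd (u *m u^T).
Proof.
by split=> [|v]; [exact: symmetric_rank1 | rewrite quad_rank1 sqr_ge0].
Qed.

Lemma psdD n (M N : 'M[R]_n) : psd M -> psd N -> psd (M + N).
Proof.
move=> [sM M0] [sN N0]; split=> [|v]; first exact: symmetricD.
by rewrite quadD addr_ge0.
Qed.

Lemma psdZ n c (M : 'M[R]_n) : 0 <= c -> psd M -> psd (c *: M).
Proof.
move=> c0 [sM M0]; split=> [|v]; first exact: symmetricZ.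
by rewrite quadZ mulr_ge0.
Qed.

Lemma psd0 n : psd (0 : 'M[R]_n).
Proof.
by split=> [|v]; [exact: trmx0 | rewrite /quad mul0mx dot0r].
Qed.

(** A zero diagonal entry of a positive semidefinite matrix annihilates its
    row. *)
Lemma psd_diag0 n (M : 'M[R]_n) k l : psd M -> M k k = 0 -> M k l = 0.
Proof.
move=> [sM M0] Mkk; have /matrixP/(_ l k) := sM; rewrite mxE => Mkl.
(* The form is affine in [t], and nonconstant if [M k l] is nonzero. *)
have qE (t : R) : quad M (delta_mx l 0 + t *: delta_mx k 0) = M l l + 2 * t * M k l.
  rewrite /quad mulmxDr -scalemxAr dotDl dotZl !dotDr !dotZr ![dot (delta_mx _ _) _]dotC.
  by rewrite !dot_delta -!colE !mxE Mkk -Mkl; ring.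
apply: (contraPeq _ M0) => Mkl0.
move=> /(_ (delta_mx l 0 + (- (M l l + 1) / (2 * M k l)) *: delta_mx k 0)).
rewrite qE (_ : _ + _ = -1) ?oppr_ge0 ?ler10//; field; exact: Mkl0.
Qed.

(** The trace inner product of positive semidefinite matrices is nonnegative.
    The proof peels off [N] one rank-one matrix per nonzero diagonal entry,
    at most. *)
Lemma trace_inner_ge0 n (M N : 'M[R]_n) : psd M -> psd N -> 0 <= trace_inner M N.
Proof.
move=> pM; have [r] := ubnP #|[pred k | N k k != 0]|.
elim: r N => // r IH N Nr pN.
have [k Nkk|N0] := pickP (fun k => N k k != 0); last first.
  rewrite trace_innerE big1// => k _; rewrite big1// => l _.
  by rewrite (psd_diag0 _ pN) ?mulr0//; apply/eqP; rewrite -[_ == _]negbK N0.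
have [sN N0] := pN.
have Nkk0 : 0 < N k k by rewrite lt_def Nkk -quad_delta N0.
pose u := col k N.
pose N' := N - (N k k)^-1 *: (u *m u^T).
have pN' : psd N'.
  split=> [|v].
    by apply: symmetricD => //; rewrite -scaleNr; apply/symmetricZ/symmetric_rank1.
  (* The minimum of the form of [N] along the line [v + t e_k]. *)
  have := N0 (v - (dot u v / N k k) *: delta_mx k 0).
  rewrite quadD quadN quadZ quad_rank1.
  set a := dot u v / N k k.
  have uE : N *m delta_mx k 0 = u by rewrite -colE.
  have vNd : dot (delta_mx k 0) (N *m v) = dot u v.
    by rewrite -uE /dot trmx_mul sN mulmxA.
  rewrite {1}/quad -scaleNr mulmxDr -scalemxAr dotDl dotZl !dotDr !dotZr uE vNd.
  rewrite -/(quad N v) (dotC v) (dotC _ u) dot_delta mxE.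
  by rewrite (_ : quad N v + _ + _ = quad N v - (N k k)^-1 * dot u v ^+ 2)// /a; field.
have N'kk : N' k k = 0 by rewrite !mxE big_ord1 !mxE mulrA mulVf ?mul1r ?subrr.
have -> : N = N' + (N k k)^-1 *: (u *m u^T) by rewrite subrK.
rewrite trace_innerC trace_innerDl trace_innerZl trace_inner_rank1.
rewrite addr_ge0//; last by rewrite mulr_ge0 ?invr_ge0 ?(ltW Nkk0)// pM.2.
rewrite trace_innerC; apply: IH => //; rewrite -ltnS (leq_trans _ Nr)// ltnS.
apply: proper_card; apply/properP; split; last first.
  by exists k; rewrite inE ?Nkk ?N'kk ?eqxx.
apply/fintype.subsetP => l; rewrite !inE; apply: contra => /eqP Nll.
rewrite !mxE big_ord1 !mxE (psd_diag0 k pN Nll) Nll.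
by rewrite mul0r mulr0 subr0.
Qed.

Lemma quad_block n (Y : 'M[R]_n) u t v a :
  quad (block_mx Y u u^T t%:M) (col_mx v (a%:M : 'M_1)) =
  quad Y v + 2 * a * dot u v + a ^+ 2 * t.
Proof.
rewrite /quad mul_block_col dot_col_mx !dotDr mul_mx_scalar dotZr (dotC v u).
rewrite !(dotE a%:M) !big_ord1 -scalar_mxM !mxE eqxx /= !mulr1n.
by rewrite -/(dot u v) -[\sum_j _](_ : dot u v = _) ?/dot ?mxE//; ring.
Qed.

(** Schur complement criterion; with [0^-1 = 0] it also covers [t = 0]. *)
Lemma psd_block n (Y : 'M[R]_n) (u : 'cV[R]_n) (t : R) :
  psd (block_mx Y u u^T t%:M) <->
  [/\ 0 <= t, t = 0 -> u = 0 & psd (Y - t^-1 *: (u *m u^T))].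
Proof.
have symB : symmetric_mx (block_mx Y u u^T t%:M) <-> symmetric_mx Y.
  rewrite /symmetric_mx tr_block_mx trmxK tr_scalar_mx.
  by split=> [/eq_block_mx[]|->].
split=> [[/symB sY B0]|[t0 u0 [sY Y0]]].
  have t0 : 0 <= t.
    by have := B0 (col_mx 0 1%:M); rewrite quad_block quad0r dot0r; lra.
  have u0 : t = 0 -> u = 0.
    move=> t00; apply: contraPP B0 => /(contra_not (@dot_eq0 _ _ _))/eqP uu0.
    (* The value of the form at this vector is -1. *)
    move=> /(_ (col_mx u (- (quad Y u + 1) / (2 * dot u u))%:M)).
    rewrite quad_block t00 mulr0 addr0 (_ : _ + _ = -1); last by field.
    by rewrite oppr_ge0 ler10.
  split=> //; split=> [|v].
    by apply: symmetricD => //; rewrite -scaleNr; apply/symmetricZ/symmetric_rank1.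
  (* The last coordinate minimizes the form for given [v]. *)
  have := B0 (col_mx v (- dot u v / t)%:M).
  rewrite quad_block quadD quadN quadZ quad_rank1.
  have [t00|tn0] := eqVneq t 0; first by rewrite (u0 t00) t00 !dot0l; lra.
  by rewrite (_ : _ + _ + _ = quad Y v - t^-1 * dot u v ^+ 2)//; field.
split=> [|w].
  apply/symB; rewrite -[Y](subrK (t^-1 *: (u *m u^T))).
  by apply: symmetricD => //; apply/symmetricZ/symmetric_rank1.
rewrite -[w]vsubmxK [dsubmx w]mx11_scalar quad_block.
move: (usubmx w) (dsubmx w 0 0) => v a.
have := Y0 v; rewrite quadD quadN quadZ quad_rank1.
have [t00|tn0] := eqVneq t 0; first by rewrite (u0 t00) t00 !dot0l; lra.
move=> Yv; rewrite (_ : _ + _ = (quad Y v - t^-1 * dot u v ^+ 2)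
  + t * (t^-1 * dot u v + a) ^+ 2); last by field.
by rewrite addr_ge0// mulr_ge0// sqr_ge0.
Qed.

(** The perspective of [P] is the smallest value of [<Y, P>] over the blocks
    [Y] that the semidefinite constraint allows. *)
Lemma quad_over_le n (t : R) (P Y : 'M[R]_n) (u : 'cV[R]_n) :
  psd P -> psd (block_mx Y u u^T t%:M) ->
  (quad_over t P u <= (trace_inner Y P)%:E)%E.
Proof.
move=> pP /psd_block[t0 u0 pY].
have : 0 <= trace_inner (Y - t^-1 *: (u *m u^T)) P by exact: trace_inner_ge0.
rewrite trace_innerDl -scaleNr trace_innerZl trace_inner_rank1 mulNr subr_ge0.
rewrite /quad_over; have [/u0 ->|tn0] := eqVneq t 0; last by rewrite lee_fin.
by rewrite quad0r eqxx mulr0 lee_fin.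
Qed.

(** When [v] vanishes together with [t], the convention at [t = 0] agrees with
    [0^-1 = 0]. *)
Lemma quad_over_fin n (t : R) (P : 'M[R]_n) (v : 'cV[R]_n) :
  (t = 0 -> v = 0) -> quad_over t P v = (t^-1 * quad P v)%:E.
Proof.
rewrite /quad_over => v0; have [/v0 ->|//] := eqVneq t 0.
by rewrite quad0r eqxx mulr0.
Qed.

End Psd.

(** * Parameter tuples and decomposable polynomials *)

Section Pairing.
Context {R : realType} {n : nat}.
Implicit Types D Z : params R n.

(** The inner product of two parameter tuples: every linear functional on
    parameters is of the form [pairing D]. *)
Definition pairing D Z : R :=
  \sum_i (trace_inner (prP D i) (prP Z i) + trace_inner (prQ D i) (prQ Z i)
          + dot (prr D i) (prr Z i) + dot (prf D i) (prf Z i)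
          + prw D i * prw Z i + prg D i * prg Z i)
  + trace_inner (prP0 D) (prP0 Z) + dot (prr0 D) (prr0 Z)
  + prw0 D * prw0 Z.

(** Componentwise sum and scaling of parameter tuples. *)
Definition addp Z Z' : params R n :=
  Params (fun i => prP Z i + prP Z' i) (fun i => prQ Z i + prQ Z' i)
    (prP0 Z + prP0 Z') (fun i => prr Z i + prr Z' i)
    (fun i => prf Z i + prf Z' i) (prr0 Z + prr0 Z')
    (fun i => prw Z i + prw Z' i) (fun i => prg Z i + prg Z' i)
    (prw0 Z + prw0 Z').

Definition scalep c Z : params R n :=
  Params (fun i => c *: prP Z i) (fun i => c *: prQ Z i) (c *: prP0 Z)
    (fun i => c *: prr Z i) (fun i => c *: prf Z i) (c *: prr0 Z)
    (fun i => c * prw Z i) (fun i => c * prg Z i) (c * prw0 Z).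

Lemma pairingC D Z : pairing D Z = pairing Z D.
Proof.
rewrite /pairing (trace_innerC (prP0 D)) (dotC (prr0 D)) (mulrC (prw0 D)).
congr (_ + _ + _ + _); apply: eq_bigr => i _.
by rewrite (trace_innerC (prP D i)) (trace_innerC (prQ D i)) (dotC (prr D i))
  (dotC (prf D i)) (mulrC (prw D i)) (mulrC (prg D i)).
Qed.

Lemma pairingDl D D' Z : pairing (addp D D') Z = pairing D Z + pairing D' Z.
Proof.
rewrite /pairing /= trace_innerDl dotDl mulrDl.
under eq_bigr => i _ do rewrite !trace_innerDl !dotDl !mulrDl.
rewrite !big_split /=; ring.
Qed.

Lemma pairingZl c D Z : pairing (scalep c D) Z = c * pairing D Z.
Proof.
rewrite /pairing /= trace_innerZl dotZl !mulrDr mulrA.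
congr (_ + _ + _ + _); rewrite mulr_sumr; apply: eq_bigr => i _.
by rewrite !trace_innerZl !dotZl; ring.
Qed.

Lemma pairingDr D Z Z' : pairing D (addp Z Z') = pairing D Z + pairing D Z'.
Proof. by rewrite !(pairingC D) pairingDl. Qed.

Lemma pairingZr c D Z : pairing D (scalep c Z) = c * pairing D Z.
Proof. by rewrite !(pairingC D) pairingZl. Qed.

(** The family whose only nonzero member is [a], at index [i]. *)
Definition single (V : nmodType) (i : 'I_n) (a : V) : 'I_n -> V :=
  fun j => if j == i then a else 0.

(** The parameter tuples with a single nonzero entry, one kind for each field. *)
Definition paramP i M : params R n :=
  Params (single i M) (fun=> 0) 0 (fun=> 0) (fun=> 0) 0 (fun=> 0) (fun=> 0) 0.
Definition paramQ i M : params R n :=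
  Params (fun=> 0) (single i M) 0 (fun=> 0) (fun=> 0) 0 (fun=> 0) (fun=> 0) 0.
Definition paramP0 M : params R n :=
  Params (fun=> 0) (fun=> 0) M (fun=> 0) (fun=> 0) 0 (fun=> 0) (fun=> 0) 0.
Definition paramr i u : params R n :=
  Params (fun=> 0) (fun=> 0) 0 (single i u) (fun=> 0) 0 (fun=> 0) (fun=> 0) 0.
Definition paramf i u : params R n :=
  Params (fun=> 0) (fun=> 0) 0 (fun=> 0) (single i u) 0 (fun=> 0) (fun=> 0) 0.
Definition paramr0 u : params R n :=
  Params (fun=> 0) (fun=> 0) 0 (fun=> 0) (fun=> 0) u (fun=> 0) (fun=> 0) 0.
Definition paramw i c : params R n :=
  Params (fun=> 0) (fun=> 0) 0 (fun=> 0) (fun=> 0) 0 (single i c) (fun=> 0) 0.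
Definition paramg i c : params R n :=
  Params (fun=> 0) (fun=> 0) 0 (fun=> 0) (fun=> 0) 0 (fun=> 0) (single i c) 0.
Definition paramw0 c : params R n :=
  Params (fun=> 0) (fun=> 0) 0 (fun=> 0) (fun=> 0) 0 (fun=> 0) (fun=> 0) c.

Lemma trace_inner0r (M : 'M[R]_n) : trace_inner M 0 = 0.
Proof. by rewrite trace_innerC trace_inner0l. Qed.

Let zeros := (@trace_inner0r, @dot0r R n, @mulr0 R, @addr0 R, @add0r R).

Lemma pairing_P D i M : pairing D (paramP i M) = trace_inner (prP D i) M.
Proof.
rewrite /pairing /= !zeros (bigD1 i)//= !zeros big1 => [|j /negbTE ji].
  by rewrite /single eqxx addr0.
by rewrite !zeros /single ji zeros.
Qed.

Lemma pairing_Q D i M : pairing D (paramQ i M) = trace_inner (prQ D i) M.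
Proof.
rewrite /pairing /= !zeros (bigD1 i)//= !zeros big1 => [|j /negbTE ji].
  by rewrite /single eqxx addr0.
by rewrite !zeros /single ji zeros.
Qed.

Lemma pairing_r D i u : pairing D (paramr i u) = dot (prr D i) u.
Proof.
rewrite /pairing /= !zeros (bigD1 i)//= !zeros big1 => [|j /negbTE ji].
  by rewrite /single eqxx addr0.
by rewrite !zeros /single ji zeros.
Qed.

Lemma pairing_f D i u : pairing D (paramf i u) = dot (prf D i) u.
Proof.
rewrite /pairing /= !zeros (bigD1 i)//= !zeros big1 => [|j /negbTE ji].
  by rewrite /single eqxx addr0.
by rewrite !zeros /single ji zeros.
Qed.

Lemma pairing_w D i c : pairing D (paramw i c) = prw D i * c.
Proof.
rewrite /pairing /= !zeros (bigD1 i)//= !zeros big1 => [|j /negbTE ji].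
  by rewrite /single eqxx addr0.
by rewrite !zeros /single ji zeros.
Qed.

Lemma pairing_g D i c : pairing D (paramg i c) = prg D i * c.
Proof.
rewrite /pairing /= !zeros (bigD1 i)//= !zeros big1 => [|j /negbTE ji].
  by rewrite /single eqxx addr0.
by rewrite !zeros /single ji zeros.
Qed.

Lemma pairing_P0 D M : pairing D (paramP0 M) = trace_inner (prP0 D) M.
Proof. by rewrite /pairing /= big1 => [|j _]; rewrite !zeros. Qed.

Lemma pairing_r0 D u : pairing D (paramr0 u) = dot (prr0 D) u.
Proof. by rewrite /pairing /= big1 => [|j _]; rewrite !zeros. Qed.

Lemma pairing_w0 D c : pairing D (paramw0 c) = prw0 D * c.
Proof. by rewrite /pairing /= big1 => [|j _]; rewrite !zeros. Qed.

(** The convex cone of parameters with positive semidefinite matrices. *)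
Definition psd_params Z : Prop :=
  (forall i, psd (prP Z i) /\ psd (prQ Z i)) /\ psd (prP0 Z).

Lemma psd_addp Z Z' : psd_params Z -> psd_params Z' -> psd_params (addp Z Z').
Proof.
move=> [PQ P0] [PQ' P0']; split=> [i|]; last exact: psdD.
by split; apply: psdD; [exact: (PQ i).1|exact: (PQ' i).1|exact: (PQ i).2|exact: (PQ' i).2].
Qed.

Lemma psd_scalep c Z : 0 <= c -> psd_params Z -> psd_params (scalep c Z).
Proof.
move=> c0 [PQ P0]; split=> [i|]; last exact: psdZ.
by split; apply: psdZ => //; [exact: (PQ i).1|exact: (PQ i).2].
Qed.

Lemma psd_single i j (M : 'M[R]_n) : psd M -> psd (single i M j).
Proof. by rewrite /single; case: eqP => // _ _; exact: psd0. Qed.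

Lemma psd_paramP i M : psd M -> psd_params (paramP i M).
Proof.
by move=> M0; split=> [j|]; [split|]; first [exact: psd_single|exact: M0|exact: psd0].
Qed.

Lemma psd_paramQ i M : psd M -> psd_params (paramQ i M).
Proof.
by move=> M0; split=> [j|]; [split|]; first [exact: psd_single|exact: M0|exact: psd0].
Qed.

Lemma psd_paramP0 M : psd M -> psd_params (paramP0 M).
Proof.
by move=> M0; split=> [j|]; [split|]; first [exact: psd_single|exact: M0|exact: psd0].
Qed.

Lemma psd_paramr i u : psd_params (paramr i u).
Proof. by split=> [j|]; [split|]; exact: psd0. Qed.

Lemma psd_paramf i u : psd_params (paramf i u).
Proof. by split=> [j|]; [split|]; exact: psd0. Qed.

Lemma psd_paramr0 u : psd_params (paramr0 u).
Proof. by split=> [j|]; [split|]; exact: psd0. Qed.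

Lemma psd_paramw i c : psd_params (paramw i c).
Proof. by split=> [j|]; [split|]; exact: psd0. Qed.

Lemma psd_paramg i c : psd_params (paramg i c).
Proof. by split=> [j|]; [split|]; exact: psd0. Qed.

Lemma psd_paramw0 c : psd_params (paramw0 c).
Proof. by split=> [j|]; [split|]; exact: psd0. Qed.

(** Explicit description of the polar cone of [psd_params]: its matrices are
    negative semidefinite and its other entries vanish, since these range
    freely in [psd_params].  [polar_le0] and [polarP] are the two inclusions, the
    second one for tuples of symmetric matrices. *)
Definition polar D : Prop :=
  [/\ forall i, sd_le (prP D i) 0, forall i, sd_le (prQ D i) 0,
      sd_le (prP0 D) 0,
      [/\ forall i, prr D i = 0, forall i, prf D i = 0 & prr0 D = 0]
    & [/\ forall i, prw D i = 0, forall i, prg D i = 0 & prw0 D = 0]].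

Lemma trace_inner_le0 (M P : 'M[R]_n) : sd_le M 0 -> psd P -> trace_inner M P <= 0.
Proof.
rewrite /sd_le sub0r => M0 P0; have := trace_inner_ge0 M0 P0.
by rewrite -scaleN1r trace_innerZl; lra.
Qed.

Lemma polar_le0 D Z : polar D -> psd_params Z -> pairing D Z <= 0.
Proof.
move=> [DP DQ DP0 [Dr Df Dr0] [Dw Dg Dw0]] [PQ P0].
rewrite /pairing Dr0 Dw0 dot0l mul0r !addr0; have := trace_inner_le0 DP0 P0.
suff : \sum_i (trace_inner (prP D i) (prP Z i) + trace_inner (prQ D i) (prQ Z i)
  + dot (prr D i) (prr Z i) + dot (prf D i) (prf Z i)
  + prw D i * prw Z i + prg D i * prg Z i) <= 0 by lra.
apply: sumr_le0 => i _; rewrite Dr Df Dw Dg !dot0l !mul0r !addr0.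
have := trace_inner_le0 (DP i) (PQ i).1; have := trace_inner_le0 (DQ i) (PQ i).2.
by lra.
Qed.

Lemma polarP D :
  (forall i, symmetric_mx (prP D i)) -> (forall i, symmetric_mx (prQ D i)) ->
  symmetric_mx (prP0 D) ->
  (forall Z, psd_params Z -> pairing D Z <= 0) -> polar D.
Proof.
move=> sP sQ sP0 D0.
have le0 M : symmetric_mx M -> (forall v, quad M v <= 0) -> sd_le M 0.
  move=> sM M0; rewrite /sd_le sub0r -scaleN1r; split=> [|v].
    exact: symmetricZ.
  by rewrite quadZ mulN1r oppr_ge0.
have dot_le0 (u : 'cV[R]_n) : (forall v, dot u v <= 0) -> u = 0.
  by move=> u0; apply/dot_eq0/le_anti; rewrite u0 dotE sumr_ge0// => k _; apply: sqr_ge0.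
have mul_le0 (a : R) : (forall c, a * c <= 0) -> a = 0.
  by move=> a0; have := a0 1; have := a0 (-1); lra.
split.
- move=> i; apply: le0 => // v; rewrite -trace_inner_rank1 trace_innerC -pairing_P.
  by apply/D0/psd_paramP/psd_rank1.
- move=> i; apply: le0 => // v; rewrite -trace_inner_rank1 trace_innerC -pairing_Q.
  by apply/D0/psd_paramQ/psd_rank1.
- apply: le0 => // v; rewrite -trace_inner_rank1 trace_innerC -pairing_P0.
  by apply/D0/psd_paramP0/psd_rank1.
- split=> [i|i|]; apply: dot_le0 => v.
  + by rewrite -pairing_r; apply/D0/psd_paramr.
  + by rewrite -pairing_f; apply/D0/psd_paramf.
  + by rewrite -pairing_r0; apply/D0/psd_paramr0.
- split=> [i|i|]; apply: mul_le0 => c.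
  + by rewrite -pairing_w; apply/D0/psd_paramw.
  + by rewrite -pairing_g; apply/D0/psd_paramg.
  + by rewrite -pairing_w0; apply/D0/psd_paramw0.
Qed.

(** The linear functional sending parameters to the coefficient of [m] in the
    polynomial they decompose. *)
Definition coef_params (m : multinom n) : params R n :=
  Params (fun i => \matrix_(k, l) mcoeff m (var i * (var k * var l)))
    (fun i => \matrix_(k, l) mcoeff m ((1 - var i) * (var k * var l)))
    (\matrix_(k, l) mcoeff m (var k * var l))
    (fun i => \col_k mcoeff m (var i * var k))
    (fun i => \col_k mcoeff m ((1 - var i) * var k))
    (\col_k mcoeff m (var k))
    (fun i => mcoeff m (var i)) (fun i => mcoeff m (1 - var i)) (mcoeff m 1).

Lemma pairing_coef m Z : pairing (coef_params m) Z = mcoeff m (decomp Z).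
Proof. by rewrite mcoeff_decomp. Qed.

Lemma decompD Z Z' : decomp (addp Z Z') = decomp Z + decomp Z'.
Proof.
by apply/mpolyP => m; rewrite mcoeffD -!pairing_coef pairingDr.
Qed.

Lemma decompZ c Z : decomp (scalep c Z) = c *: decomp Z.
Proof.
by apply/mpolyP => m; rewrite mcoeffZ -!pairing_coef pairingZr.
Qed.

Lemma decomp_P i M : decomp (paramP i M) = var i * qform M.
Proof.
by apply/mpolyP => m; rewrite -pairing_coef pairing_P mcoeff_mul_qform.
Qed.

Lemma decomp_Q i M : decomp (paramQ i M) = (1 - var i) * qform M.
Proof.
by apply/mpolyP => m; rewrite -pairing_coef pairing_Q mcoeff_mul_qform.
Qed.

Lemma decomp_r i u : decomp (paramr i u) = var i * lform u.
Proof.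
by apply/mpolyP => m; rewrite -pairing_coef pairing_r mcoeff_mul_lform.
Qed.

Lemma decomp_r0 u : decomp (paramr0 u) = lform u.
Proof.
apply/mpolyP => m; rewrite -pairing_coef pairing_r0 -[lform u]mul1r mcoeff_mul_lform.
by congr dot; apply/matrixP => k l; rewrite !mxE mul1r.
Qed.

Lemma decomp_w0 c : decomp (paramw0 c) = mpolyC n c.
Proof.
apply/mpolyP => m; rewrite -pairing_coef pairing_w0 /= -[mpolyC n c]mulr1.
by rewrite mcoeffCM mulrC.
Qed.

Lemma lformD (u v : 'cV[R]_n) : lform (u + v) = lform u + lform v.
Proof. by rewrite -big_split; apply: eq_bigr => k _; rewrite mxE scalerDl. Qed.

Lemma lformZ c (u : 'cV[R]_n) : lform (c *: u) = c *: lform u.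
Proof.
by rewrite scaler_sumr; apply: eq_bigr => k _; rewrite mxE scalerA.
Qed.

Lemma lform_delta k : lform (delta_mx k 0 : 'cV[R]_n) = var k.
Proof.
rewrite /lform (bigD1 k)//= mxE !eqxx scale1r big1 ?addr0// => l lk.
by rewrite mxE (negbTE lk) scale0r.
Qed.

Lemma qform_rank1 (u : 'cV[R]_n) : qform (u *m u^T) = lform u * lform u.
Proof.
rewrite /qform {1}/lform mulr_suml; apply: eq_bigr => k _.
rewrite mulr_sumr; apply: eq_bigr => l _.
by rewrite !mxE big_ord1 mxE -scalerAl -scalerAr scalerA.
Qed.

(** The polynomials that have a decomposition with positive semidefinite
    matrices. *)
Definition decomposable (q : mpoly n R) : Prop :=
  exists Z, psd_params Z /\ decomp Z = q.

Lemma decomposableD p q :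
  decomposable p -> decomposable q -> decomposable (p + q).
Proof.
move=> [Z [Z0 <-]] [Z' [Z'0 <-]]; exists (addp Z Z').
by split; [exact: psd_addp | exact: decompD].
Qed.

Lemma decomposableZ c p : 0 <= c -> decomposable p -> decomposable (c *: p).
Proof.
move=> c0 [Z [Z0 <-]]; exists (scalep c Z).
by split; [exact: psd_scalep | exact: decompZ].
Qed.

Lemma decomposableC c : decomposable (mpolyC n c).
Proof. by exists (paramw0 c); rewrite decomp_w0; split=> //; exact: psd_paramw0. Qed.

Lemma decomposable_sum (I : finType) (F : I -> mpoly n R) :
  (forall i, decomposable (F i)) -> decomposable (\sum_i F i).
Proof.
move=> dF; apply: (big_ind decomposable) => //; last exact: decomposableD.
by rewrite -[0]/(0 : mpoly n R) -mpolyC0; exact: decomposableC.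
Qed.

Lemma decomposable_lform u : decomposable (lform u).
Proof. by exists (paramr0 u); rewrite decomp_r0; split=> //; exact: psd_paramr0. Qed.

(** Quadratic terms, of either sign, come from the vectors [r^k]. *)
Lemma decomposable_lform2 u v : decomposable (lform u * lform v).
Proof.
rewrite {1}/lform mulr_suml; apply: decomposable_sum => k.
exists (paramr k (u k 0 *: v)); rewrite decomp_r lformZ -scalerAr -scalerAl.
by split=> //; exact: psd_paramr.
Qed.

(** Cubic terms.  Positive and negative multiples alike are decomposable, by
    the identity
    [4 x_i u v = x_i (u + v)^2 + (1 - x_i) (u - v)^2 - (u - v)^2]
    whose last term is quadratic. *)
Lemma decomposable_lform3 i u v : decomposable (var i * (lform u * lform v)).
Proof.
have -> : var i * (lform u * lform v) = 4^-1 *: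
    (var i * qform ((u + v) *m (u + v)^T)
     + (1 - var i) * qform ((u + (-1) *: v) *m (u + (-1) *: v)^T)
     + lform (u + (-1) *: v) * lform ((-1) *: (u + (-1) *: v))).
  rewrite !qform_rank1 !(lformD, lformZ) !scaleN1r.
  set w := (X in _ *: X); have -> : w = 4%:R *: (var i * (lform u * lform v)).
    by rewrite scaler_nat -mulr_natl /w; ring.
  by rewrite scalerA mulVf ?scale1r// pnatr_eq0.
apply: decomposableZ; first by rewrite invr_ge0 ler0n.
apply: decomposableD; last exact: decomposable_lform2.
apply: decomposableD.
  by rewrite -decomp_P; exists (paramP i ((u + v) *m (u + v)^T)); split=> //;
    apply/psd_paramP/psd_rank1.
rewrite -decomp_Q; eexists; split; last by [].
exact/psd_paramQ/psd_rank1.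
Qed.

Lemma decomposable_monomial c (m : multinom n) :
  (mdeg m < 4)%N -> decomposable (c *: mpolyX R m).
Proof.
(* A monomial of positive degree is divisible by a variable. *)
have factor (m' : multinom n) d : mdeg m' = d.+1 ->
    exists i m1, mpolyX R m' = var i * mpolyX R m1 /\ mdeg m1 = d.
  move=> m'd; have [i m'i] : exists i, m' i != 0%N.
    apply/existsP; rewrite -negb_forall; apply/negP => /forallP m'0.
    by move: m'd; rewrite mdegE big1// => i _; apply/eqP.
  exists i, (mnm_sub m' (mnm1 i)); rewrite /var -mpolyXD.
  have mE : mnm_add (mnm1 i) (mnm_sub m' (mnm1 i)) = m'.
    by rewrite addmC submK// lep1mP.
  split; first by rewrite mE.
  by apply: succn_inj; rewrite -m'd -[in RHS]mE mdegD mdeg1.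
have X0 (m' : multinom n) : mdeg m' = 0%N -> mpolyX R m' = 1.
  by move/eqP; rewrite mdeg_eq0 => /eqP ->; rewrite mpolyX0.
move dE : (mdeg m) => [|[|[|[|//]]]] _.
- by rewrite X0// -mul_mpolyC mulr1; exact: decomposableC.
- have [i [m1 [-> /X0 ->]]] := factor _ _ dE.
  by rewrite mulr1 -lform_delta -lformZ; exact: decomposable_lform.
- have [i [m1 [-> /factor [k [m2 [-> /X0 ->]]]]]] := factor _ _ dE.
  by rewrite mulr1 scalerAr -!lform_delta -lformZ; exact: decomposable_lform2.
- have [i [m1 [-> /factor [k [m2 [-> /factor [l [m3 [-> /X0 ->]]]]]]]]] :=
    factor _ _ dE.
  rewrite mulr1 !scalerAr -(lform_delta k) -(lform_delta l) -lformZ.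
  exact: decomposable_lform3.
Qed.

(** Every right-hand side of the linear system is attained on the cone
    [psd_params]. *)
Lemma coef_surj (s : 'cV[R]_(nmon n)) :
  exists2 Z, psd_params Z & forall j, pairing (coef_params (mon j)) Z = s j 0.
Proof.
have [Z [Z0 ZE]] : decomposable (\sum_j s j 0 *: mpolyX R (mon j)).
  by apply: decomposable_sum => j; apply: decomposable_monomial; rewrite bmdeg.
exists Z => // j; rewrite pairing_coef ZE raddf_sum /= (bigD1 j)//= big1 => [|k kj].
  by rewrite mcoeffZ mcoeffX eqxx mulr1 addr0.
rewrite mcoeffZ mcoeffX; case: eqP => [/val_inj/enum_val_inj jk|]; last by rewrite mulr0.
by rewrite jk eqxx in kj.
Qed.

End Pairing.

(** * Duality at a fixed point *)

Section Duality.
Context {R : realType} {n : nat}.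
Implicit Types (x : 'cV[R]_n) (U : 'M[R]_n) (Z : params R n).

(** The multipliers [lam] as a functional on parameter tuples, see
    [pairing_comb]. *)
Definition comb_params (lam : 'cV[R]_(nmon n)) : params R n :=
  Params (fun i => \sum_j lam j 0 *: dataA j i)
    (fun i => \sum_j lam j 0 *: dataB j i) (\sum_j lam j 0 *: dataXi j)
    (fun i => \sum_j lam j 0 *: datac j i) (fun i => \sum_j lam j 0 *: datad j i)
    (\sum_j lam j 0 *: dataomega j) (fun i => \sum_j lam j 0 * datamu j i)
    (fun i => \sum_j lam j 0 * datanu j i) (\sum_j lam j 0 * datagamma j).

Lemma trace_inner_suml (I : Type) (r : seq I) (a : I -> R) (M : I -> 'M[R]_n) P :
  trace_inner (\sum_(j <- r) a j *: M j) P = \sum_(j <- r) a j * trace_inner (M j) P.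
Proof.
elim: r => [|j r IH]; first by rewrite !big_nil trace_inner0l.
by rewrite !big_cons trace_innerDl trace_innerZl IH.
Qed.

Lemma dot_suml (I : Type) (r : seq I) (a : I -> R) (u : I -> 'cV[R]_n) v :
  dot (\sum_(j <- r) a j *: u j) v = \sum_(j <- r) a j * dot (u j) v.
Proof.
elim: r => [|j r IH]; first by rewrite !big_nil dot0l.
by rewrite !big_cons dotDl dotZl IH.
Qed.

Lemma pairing_comb lam Z :
  pairing (comb_params lam) Z =
  \sum_j lam j 0 * pairing (coef_params (mon j)) Z.
Proof.
rewrite {1}/pairing /= trace_inner_suml dot_suml mulr_suml.
under eq_bigr => i _ do
  rewrite !trace_inner_suml !dot_suml !mulr_suml -!big_split /=.
rewrite exchange_big /= -!big_split /=; apply: eq_bigr => j _.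
rewrite /pairing /= !mulrDr mulrA.
by congr (_ + _ + _ + _); rewrite mulr_sumr; apply: eq_bigr => i _; rewrite !mulrDr !mulrA.
Qed.

Lemma symmetric_sum (I : Type) (r : seq I) (a : I -> R) (M : I -> 'M[R]_n) :
  (forall j, symmetric_mx (M j)) -> symmetric_mx (\sum_(j <- r) a j *: M j).
Proof.
move=> sM; rewrite /symmetric_mx linear_sum; apply: eq_bigr => j _.
exact/symmetricZ.
Qed.

(** The variables of the second problem as a functional on parameter tuples;
    adding [comb_params lam] gives the left-hand sides of the constraints that
    involve [lam]. *)
Definition dual_params x U (Y W : 'I_n -> 'M[R]_n) (Yn : 'M[R]_n) : params R n :=
  Params Y W Yn (fun i => col i U) (fun i => x - col i U) x
    (fun i => x i 0) (fun i => 1 - x i 0) 1.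

Lemma g3_le_pairing x U Y W Yn Z :
  psd_params Z ->
  (forall i, psd (block_mx (Y i) (col i U) (col i U)^T (x i 0)%:M)) ->
  (forall i, psd (block_mx (W i) (x - col i U) (x - col i U)^T (1 - x i 0)%:M)) ->
  psd (block_mx Yn x x^T 1%:M) ->
  (g3 x U Z <= (pairing (dual_params x U Y W Yn) Z)%:E)%E.
Proof.
move=> [PQ P0] BY BW Bn; rewrite /g3 /pairing /= -!addrA [leRHS]EFinD -sumEFin.
apply: leeD; last first.
  rewrite lee_fin; have := quad_over_le P0 Bn.
  by rewrite /quad_over oner_eq0 invr1 mul1r lee_fin; lra.
apply: lee_sum => i _; have [Pi Qi] := PQ i.
apply: (@le_trans _ _ ((trace_inner (Y i) (prP Z i))%:E
  + (dot (col i U) (prr Z i) + prw Z i * x i 0)%:E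
  + (trace_inner (W i) (prQ Z i))%:E
  + (dot (x - col i U) (prf Z i) + (1 - x i 0) * prg Z i)%:E)%E).
  by rewrite !leeD//; apply: quad_over_le.
by rewrite -!EFinD lee_fin; lra.
Qed.

(** The dual blocks that are smallest in the semidefinite order. *)
Definition schur_params x U : params R n :=
  dual_params x U (fun i => (x i 0)^-1 *: (col i U *m (col i U)^T))
    (fun i => (1 - x i 0)^-1 *: ((x - col i U) *m (x - col i U)^T)) (x *m x^T).

(** The condition for [g3] to be finite: a perspective with zero denominator
    must have a zero numerator. *)
Definition nondegenerate x U : Prop :=
  forall i, (x i 0 = 0 -> col i U = 0) /\ (1 - x i 0 = 0 -> x - col i U = 0).

Lemma g3_nondegenerate x U Z :
  nondegenerate x U -> g3 x U Z = (pairing (schur_params x U) Z)%:E.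
Proof.
move=> nd; rewrite /g3 /pairing /= -!addrA [RHS]EFinD -sumEFin; congr (_ + _)%E.
  apply: eq_bigr => i _; have [xU0 xU1] := nd i.
  rewrite !quad_over_fin// -!EFinD !trace_innerZl !trace_inner_rank1.
  by congr EFin; ring.
by rewrite trace_inner_rank1 mul1r.
Qed.

Lemma quad_over_neqNy (t : R) (P : 'M[R]_n) v : quad_over t P v != -oo%E.
Proof. by rewrite /quad_over; case: ifP => //; case: ifP. Qed.

Lemma g3_eqy x U Z i :
  quad_over (x i 0) (prP Z i) (col i U) = +oo%E \/
  quad_over (1 - x i 0) (prQ Z i) (x - col i U) = +oo%E ->
  g3 x U Z = +oo%E.
Proof.
move=> PQy; rewrite /g3.
have addy (a c : \bar R) : a = +oo%E -> c != -oo%E -> (a + c = +oo)%E.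
  by move=> -> c0; rewrite addye.
apply: addy => //.
apply/esum_eqyP => [j _|].
  by rewrite !adde_eq_ninfty !negb_or !quad_over_neqNy.
exists i; split=> //.
case: PQy => ->; first by rewrite !addye//= ?adde_eq_ninfty ?negb_or quad_over_neqNy.
by rewrite addey ?addye// adde_eq_ninfty negb_or quad_over_neqNy.
Qed.

(** Decompositions of [p] exist with any prescribed positive semidefinite
    summand [E]. *)
Lemma Zset_add (p : mpoly n R) E :
  psd_params E -> exists2 Z, psd_params Z & Zset p (addp E Z).
Proof.
move=> E0.
have [Z Z0 ZE] := coef_surj
  (\col_j (datas p j - pairing (coef_params (mon j)) E)).
exists Z => //; have EZ0 := psd_addp E0 Z0; split=> // j.
rewrite /coeff_eq -[LHS]/(pairing (coef_params (mon j)) _) pairingDr ZE mxE.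
by rewrite addrC subrK.
Qed.

(** If a numerator did not vanish, a decomposition with the summand [U_i U_i^T] in [P^i], or
    the analogous one in [Q^i], makes [g3] infinite. *)
Lemma nondegenerate_of_bounded (p : mpoly n R) x U (v : R) :
  (forall Z, Zset p Z -> (g3 x U Z <= v%:E)%E) -> nondegenerate x U.
Proof.
have pos (u : 'cV[R]_n) (P : 'M[R]_n) : u <> 0 -> psd P -> quad (u *m u^T + P) u != 0.
  move=> u0 [_ P0]; rewrite quadD quad_rank1 gt_eqF// ltr_wpDr//.
  by rewrite exprn_even_gt0//=; apply/eqP => /dot_eq0.
move=> gv i; split=> t0; apply: contrapT => u0.
  have [Z [PQ _] pZ] := Zset_add p (psd_paramP i (psd_rank1 (col i U))).
  have := gv _ pZ; rewrite (@g3_eqy _ _ _ i)//; left.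
  by rewrite /quad_over t0 eqxx /= /single eqxx (negbTE (pos _ _ u0 (PQ i).1)).
have [Z [PQ _] pZ] := Zset_add p (psd_paramQ i (psd_rank1 (x - col i U))).
have := gv _ pZ; rewrite (@g3_eqy _ _ _ i)//; right.
by rewrite /quad_over t0 eqxx /= /single eqxx (negbTE (pos _ _ u0 (PQ i).2)).
Qed.

(** Weak duality. *)
Lemma g3_le_sdp_objective (p : mpoly n R) C x U Y W lam Z :
  sdp_feasible C (x, U, Y, W, lam) -> Zset p Z ->
  (g3 x U Z <= (sdp_objective p (x, U, Y, W, lam))%:E)%E.
Proof.
move=> [_ [DP DQ DP0] [Dr Df Dr0 Dw [Dg Dw0]] [BY BW Bn] _] [pZ Z0].
apply: le_trans (g3_le_pairing Z0 BY BW Bn) _; rewrite lee_fin.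
have pol : polar (addp (dual_params x U (fun i => Y (widen_ord (leqnSn n) i)) W
    (Y ord_max)) (comb_params lam)) by [].
have := polar_le0 pol Z0; rewrite pairingDl pairing_comb.
rewrite (eq_bigr (fun j => lam j 0 * datas p j)) => [|j _]; last first.
  by rewrite -(pZ j).
by rewrite /sdp_objective; lra.
Qed.

(** Strong duality with attainment, for the cone of pairs
    (right-hand side, value) over [psd_params]. *)
Lemma sdp_feasible_of_bounded (p : mpoly n R) (C : set ('cV[R]_n * 'M[R]_n)) x U (v : R) :
  C (x, U) -> (forall i, 0 <= x i 0 <= 1) ->
  (forall Z, Zset p Z -> (g3 x U Z <= v%:E)%E) ->
  exists Y W lam, sdp_feasible C (x, U, Y, W, lam) /\
    sdp_objective p (x, U, Y, W, lam) <= v.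
Proof.
move=> CxU x01 gv; have nd := nondegenerate_of_bounded gv.
pose D := schur_params x U.
pose G (s : 'cV[R]_(nmon n)) (r : R) := exists2 Z, psd_params Z &
  (forall j, pairing (coef_params (mon j)) Z = s j 0) /\ pairing D Z = r.
have [||||lam [lamG lamv]] := @cone_duality R _ G (\col_j datas p j) v.
- move=> s s' r r' [Z Z0 [Zs Zr]] [Z' Z'0 [Zs' Zr']].
  exists (addp Z Z'); first exact: psd_addp.
  by split=> [j|]; rewrite pairingDr ?Zs ?Zs' ?mxE ?Zr ?Zr'.
- move=> c s r c0 [Z Z0 [Zs Zr]]; exists (scalep c Z).
    exact: psd_scalep (ltW c0) Z0.
  by split=> [j|]; rewrite pairingZr ?Zs ?mxE ?Zr.
- by move=> s; have [Z Z0 Zs] := coef_surj s; exists (pairing D Z), Z.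
- move=> r [Z Z0 [Zs <-]]; rewrite -lee_fin -g3_nondegenerate//; apply: gv.
  by split=> // j; rewrite /coeff_eq -[LHS]/(pairing (coef_params (mon j)) Z) Zs mxE.
have pol : polar (addp D (comb_params lam)).
  have symD i (a : mpoly n R) : symmetric_mx
      (\matrix_(k, l) mcoeff i (a * (var k * var l)) : 'M[R]_n).
    by apply/matrixP => k l; rewrite !mxE (mulrC (var k)).
  apply: polarP => [i|i||Z Z0].
  - apply: symmetricD; first exact/symmetricZ/symmetric_rank1.
    by apply: symmetric_sum => j; apply: symD.
  - apply: symmetricD; first exact/symmetricZ/symmetric_rank1.
    by apply: symmetric_sum => j; apply: symD.
  - apply: symmetricD; first exact/symmetric_rank1.
    apply: symmetric_sum => j; rewrite -[dataXi j]/(\matrix_(_, _) _).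
    by apply/matrixP => k l; rewrite !mxE mulrC.
  - rewrite pairingDl pairing_comb.
    have := lamG (\col_j pairing (coef_params (mon j)) Z) (pairing D Z) _.
    rewrite dotE; under eq_bigr => j _ do rewrite mxE.
    by apply; exists Z => //; split=> // j; rewrite mxE.
pose Y (k : 'I_n.+1) := if unlift ord_max k is Some i then prP D i else prP0 D.
have YiE i : Y (widen_ord (leqnSn n) i) = prP D i.
  rewrite /Y (_ : widen_ord _ i = lift ord_max i) ?liftK//.
  by apply: val_inj; rewrite /= /bump leqNgt ltn_ord.
have YnE : Y ord_max = prP0 D by rewrite /Y unlift_none.
have [DP DQ DP0 [Dr Df Dr0] [Dw Dg Dw0]] := pol.
have block_schur t (u : 'cV[R]_n) : 0 <= t -> (t = 0 -> u = 0) ->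
    psd (block_mx (t^-1 *: (u *m u^T)) u u^T t%:M).
  by move=> t0 tu; apply/psd_block; split=> //; rewrite subrr; exact: psd0.
exists Y, (prQ D), lam; split; last first.
  move: lamv; rewrite dotE; under eq_bigr => j _ do rewrite mxE.
  by [].
split.
- split=> [k|i]; last exact/symmetricZ/symmetric_rank1.
  rewrite /Y; case: unlift => [i|]; last exact: symmetric_rank1.
  exact/symmetricZ/symmetric_rank1.
- by rewrite YnE; split=> [i|i|]; [rewrite YiE; exact: DP|exact: DQ|exact: DP0].
- by split.
- split.
  + move=> i; rewrite YiE; have /andP[x0 _] := x01 i.
    exact: block_schur x0 (nd i).1.
  + move=> i; have /andP[_ x1] := x01 i; rewrite -subr_ge0 in x1.
    exact: block_schur x1 (nd i).2.
  + rewrite YnE; have := block_schur 1 x ler01; rewrite invr1 scale1r; apply.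
    by move/eqP; rewrite oner_eq0.
- exact: CxU.
Qed.

Lemma nondegenerate_rank1 x : nondegenerate x (x *m x^T).
Proof.
have colE i : col i (x *m x^T) = x i 0 *: x.
  by apply/matrixP => k j; rewrite (ord1 j) !mxE big_ord1 !mxE mulrC.
move=> i; rewrite colE; split=> [->|x1]; first by rewrite scale0r.
by rewrite -[X in X - _]scale1r -scalerBl x1 scale0r.
Qed.

Lemma meval_qform x (M : 'M[R]_n) : meval (fun i => x i 0) (qform M) = quad M x.
Proof.
rewrite /qform quadE raddf_sum /=; apply: eq_bigr => k _; rewrite raddf_sum /=.
by apply: eq_bigr => l _; rewrite mevalZ mevalM !mevalXU.
Qed.

Lemma meval_lform x (u : 'cV[R]_n) : meval (fun i => x i 0) (lform u) = dot x u.
Proof.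
rewrite /lform dotE raddf_sum /=; apply: eq_bigr => k _.
by rewrite mevalZ !mevalXU mulrC.
Qed.

(** The relaxation is exact at rank-one points. *)
Lemma g3_rank1 x Z :
  g3 x (x *m x^T) Z = (meval (fun i => x i 0) (decomp Z))%:E.
Proof.
rewrite g3_nondegenerate; last exact: nondegenerate_rank1.
have colE i : col i (x *m x^T) = x i 0 *: x.
  by apply/matrixP => k j; rewrite (ord1 j) !mxE big_ord1 !mxE mulrC.
rewrite /decomp !mevalD !meval_qform !meval_lform !mevalC 2!raddf_sum -big_split /=.
rewrite /pairing /= trace_inner_rank1 mul1r; congr (_ + _ + _ + _)%:E.
apply: eq_bigr => i _; rewrite !trace_innerZl !trace_inner_rank1 colE.
have -> : x - x i 0 *: x = (1 - x i 0) *: x by rewrite scalerBl scale1r.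
rewrite !quadZr !dotZl.
rewrite !mevalM !mevalD mevalN meval1 !meval_qform !meval_lform !mevalC !mevalXU.
have invE (t q : R) : t^-1 * (t ^+ 2 * q) = t * q.
  by have [->|t0] := eqVneq t 0; [rewrite invr0 !mul0r | field].
by rewrite !invE; ring.
Qed.

End Duality.

(** * The equivalence of the two problems *)

Theorem theorem2 (R : realType) (n : nat)
    (p3 : mpoly n R) (p3_deg : msize p3 = 4%N)
    (L J : nat) (A : 'M[R]_(L, n)) (b : 'cV[R]_L)
    (h : 'I_J -> 'cV[R]_n -> \bar R)
    (h_proper : forall j, proper_fun (h j))
    (h_closed : forall j, closed_fun (h j))
    (h_convex : forall j, convex_fun (h j))
    (X_box : region A b h `<=` [set x : 'cV[R]_n | forall i, 0 <= x i 0 <= 1])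
    (Phi : 'I_L + 'I_J -> 'I_L + 'I_J -> 'cV[R]_n -> 'M[R]_n -> \bar R)
    (Phi_lin : linearization A b h Phi)
    (Xbar_convex : convex_set (lifted_region A b h Phi))
    (x : 'cV[R]_n) (U : 'M[R]_n) :
  minimizer (lifted_region A b h Phi)
    (fun xU => ereal_sup [set g3 xU.1 xU.2 Z | Z in Zset p3]) (x, U)
  <->
  exists (Y : 'I_n.+1 -> 'M[R]_n) (W : 'I_n -> 'M[R]_n) (lam : 'cV[R]_(nmon n)),
    minimizer (sdp_feasible (lifted_region A b h Phi)) (sdp_objective p3)
      (x, U, Y, W, lam).
Proof.
set C := lifted_region A b h Phi.
have p3_le4 : (msize p3 <= 4)%N by rewrite p3_deg.
pose F (y : 'cV[R]_n) (V : 'M[R]_n) : \bar R :=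
    ereal_sup [set g3 y V Z | Z in Zset p3].
have FleE y V (v : R) : (F y V <= v%:E)%E <->
    forall Z, Zset p3 Z -> (g3 y V Z <= v%:E)%E.
  split=> [Fv Z pZ|gv]; first by apply: le_trans Fv; apply: ereal_sup_ubound; exists Z.
  by apply: ge_ereal_sup => _ [Z pZ <-]; apply: gv.
have box y V : C (y, V) -> forall i, 0 <= y i 0 <= 1 by case=> /X_box.
have weak y V Y W lam : sdp_feasible C (y, V, Y, W, lam) ->
    (F y V <= (sdp_objective p3 (y, V, Y, W, lam))%:E)%E.
  by move=> feas; apply/FleE => Z; apply: g3_le_sdp_objective feas.
have strong y V v : C (y, V) -> (F y V <= v%:E)%E -> exists Y W lam,
    sdp_feasible C (y, V, Y, W, lam) /\ sdp_objective p3 (y, V, Y, W, lam) <= v.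
  by move=> CyV /FleE; apply: sdp_feasible_of_bounded => //; apply: box CyV.
split=> [[CxU xUmin]|[Y [W [lam [feas optim]]]]].
- have Fub : (F x U <= (meval (fun i => x i 0) p3)%:E)%E.
    have Cx : C (x, x *m x^T) by apply: rank1_lifted_region => //; case: CxU.
    apply: le_trans (xUmin _ Cx) _; apply/FleE => Z [pZ _].
    by rewrite g3_rank1; have /coeff_eqP <- := pZ.
  have [Y0 [W0 [lam0 [feas0 _]]]] := strong _ _ _ CxU Fub.
  have Ffin : F x U \is a fin_num.
    have nd := nondegenerate_of_bounded ((FleE _ _ _).1 Fub).
    have [Z Z0 pZ] := Zset_add p3 (psd_paramw0 0).
    rewrite fin_numElt (le_lt_trans Fub (ltry _)) andbT.
    apply: (@lt_le_trans _ _ (g3 x U (addp (paramw0 0) Z))).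
      by rewrite g3_nondegenerate// ltNyr.
    by apply: ereal_sup_ubound; eexists; first exact: pZ.
  have [|Y [W [lam [feas obj]]]] := strong x U (fine (F x U)) CxU.
    by rewrite fineK.
  exists Y, W, lam; split=> // -[[[[y V] Y'] W'] lam'] feas'.
  rewrite -lee_fin; apply: le_trans (weak _ _ _ _ _ feas').
  apply: le_trans (xUmin (y, V) _); last by case: feas'.
  by rewrite -[X in (_ <= X)%E]fineK// lee_fin.
- have CxU : C (x, U) by case: feas.
  split=> // -[y V] CyV; rewrite -/(F x U) -/(F y V).
  have Fo := weak _ _ _ _ _ feas.
  case FyV : (F y V) => [v||]; last 2 first.
  + by rewrite leey.
  + (* This case is impossible: a supremum [-oo] lies below every real, so
       strong duality would give a feasible point that beats the optimum. *)
    have [|Y' [W' [lam' [feas' obj']]]] :=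
        strong y V (sdp_objective p3 (x, U, Y, W, lam) - 1) CyV.
      by rewrite FyV leNye.
    have := le_trans (optim _ feas') obj'.
    by rewrite -subr_ge0 addrAC subrr sub0r oppr_ge0 ler10.
  have [|Y' [W' [lam' [feas' obj']]]] := strong y V v CyV; first by rewrite FyV.
  apply: le_trans Fo _; rewrite lee_fin.
  exact: le_trans (optim _ feas') obj'.
Qed.
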